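(* For every fixed integer $d\ge 3$ and all sufficiently large $n$ (depending on $d$), \[ f(d,n)\ \ge\ \frac{n^{\,1-\frac{2d-1}{d(d-1)}}}{8\log n}, \] where $f(d,n)$ is the maximum value of $\dim(P)$ among all posets $P$ on $n$ points with $\operatorname{se}(P)<d$.
   Context: $\log$ is the natural logarithm. The dimension $\dim(P)$ of a poset $P$ is the least positive integer $t$ for which there are linear extensions $L_1,\dots,L_t$ of $P$ such that $x\le y$ in $P$ if and only if $x\le y$ in $L_j$ for each $j\in\{1,\dots,t\}$. For $d\ge2$, the standard example $S_d$ is the height-2 poset with minimal elements $a_1,\dots,a_d$ and maximal elements $a'_1,\dots,a'_d$, in which $a_i<a'_j$ if and only if $i\ne j$. The standard example number $\operatorname{se}(P)$ is $1$ if $P$ contains no subposet isomorphic to $S_2$; otherwise it is the largest $d\ge2$ such that $P$ contains a subposet isomorphic to $S_d$. *)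

(* Defs.v *)
From HB Require Import structures.
From mathcomp Require Import all_boot all_order boolp.
From mathcomp Require Import zify.

Set Implicit Arguments.
Unset Strict Implicit.
Unset Printing Implicit Defensive.

Import Order.TTheory.

Local Open Scope order_scope.

Section Dimension.
Context {disp : Order.disp_t}.
Implicit Type P : finPOrderType disp.

Definition linear_extension P (L : rel P) : Prop :=
  [/\ reflexive L, antisymmetric L, transitive L, total L
    & forall x y, x <= y -> L x y].

Definition realizer P t (L : 'I_t -> rel P) : Prop :=
  (forall j, linear_extension (L j)) /\
  (forall x y, x <= y <-> forall j, L j x y).

Definition has_realizer P (t : nat) : bool :=
  `[< exists L : 'I_t -> rel P, realizer L >].

(* Given a down-set A, list A before its complement; within each part, sort by
   the number of elements below, and break ties by the enumeration of P. *)
Let key P (A : pred P) (z : P) : nat :=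
  ((~~ A z * #|P|.+1 + #|[set w | (w <= z)%O]|) * #|P|.+1 + enum_rank z)%N.

Let key_linear P (A : pred P) : (forall x y, x <= y -> A y -> A x) ->
  linear_extension (fun x y => key A x <= key A y)%N.
Proof.
move=> A_down.
have rank_lt (z : P) : (enum_rank z < #|P|.+1)%N by rewrite ltnS ltnW.
split=> [x|x y|y x z|x y|x y le_xy].
- exact: leqnn.
- rewrite -eqn_leq => /eqP eq_key; apply/enum_rank_inj/val_inj => /=.
  have : (key A x %% #|P|.+1 = key A y %% #|P|.+1)%N by rewrite eq_key.
  by rewrite /key !modnMDl !modn_small.
- exact: leq_trans.
- exact: leq_total.
- have [->|neq_xy] := eqVneq x y; first exact: leqnn.
  have lt_card : (#|[set w | (w <= x)%O]| < #|[set w | (w <= y)%O]|)%N.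
    apply: proper_card; apply/properP; split.
      by apply/subsetP => w; rewrite !inE => /le_trans; apply.
    exists y; rewrite !inE // ; apply: contra neq_xy => le_yx.
    by rewrite eq_le le_xy.
  have le_A : (~~ A x <= ~~ A y)%N.
    by move: (A_down x y le_xy); case: (A x); case: (A y) => // /(_ isT).
  have := rank_lt x; rewrite /key; move: lt_card le_A.
  move: #|_| #|[set w | (w <= y)%O]| (nat_of_bool _) (nat_of_bool _) #|P|.+1.
  move: (nat_of_ord _) (nat_of_ord _) => i j a b u v n; nia.
Qed.

Lemma realizer_exists P : exists t, (0 < t)%N && has_realizer P t.
Proof.
pose A (o : option P) : pred P := fun z => if o is Some y then z <= y else true.
exists #|{: option P}|; rewrite card_option /=; apply/asboolP.
rewrite -card_option; exists (fun j x y => key (A (enum_val j)) x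
                                 <= key (A (enum_val j)) y)%N.
have lin o : linear_extension (fun x y => key (A o) x <= key (A o) y)%N.
  by apply: key_linear => x y le_xy; case: o => //= z; apply: le_trans.
split=> [j|x y]; first exact: lin.
split=> [le_xy j|]; first by case: (lin (enum_val j)) => _ _ _ _; apply.
move=> /(_ (enum_rank (Some y))); rewrite enum_rankK /key /= lexx /=.
apply: contraTT => nle_xy; rewrite nle_xy -ltnNge mul0n add0n mul1n.
have : (#|[set w | (w <= y)%O]| < #|P|.+1)%N by rewrite ltnS max_card.
have : (enum_rank y < #|P|.+1)%N by rewrite ltnS ltnW.
move: (nat_of_ord _) (nat_of_ord _) #|[set w | (w <= y)%O]| #|[set w | (w <= x)%O]|.
move: #|P|.+1 => n i j u v; nia.
Qed.

Definition dim P : nat := ex_minn (realizer_exists P).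

End Dimension.

(* [inl i] is the minimal element a_i and [inr j] the maximal element a'_j. *)
Definition standard_example (d : nat) : Type := ('I_d + 'I_d)%type.

HB.instance Definition _ d := Finite.on (standard_example d).

Definition standard_le d (x y : standard_example d) : bool :=
  match x, y with
  | inl i, inl j => i == j
  | inl i, inr j => i != j
  | inr i, inr j => i == j
  | inr _, inl _ => false
  end.

Lemma standard_le_refl d : reflexive (@standard_le d).
Proof. by case=> i /=. Qed.

Lemma standard_le_anti d : antisymmetric (@standard_le d).
Proof. by case=> i [] j //=; [move/andP=> [/eqP->] | rewrite andbF | move/andP=> [/eqP->]]. Qed.

Lemma standard_le_trans d : transitive (@standard_le d).
Proof. by case=> j [] i [] k //=; [move=> /eqP-> | move=> /eqP-> | move=> ij /eqP<- | move=> /eqP->]. Qed.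

HB.instance Definition _ d := Order.Le_isPOrder.Build (Order.Disp tt tt)
  (standard_example d) (@standard_le_refl d) (@standard_le_anti d)
  (@standard_le_trans d).

(* By antisymmetry, a map that preserves and reflects the order is injective,
   hence an isomorphism from Q onto a subposet of P. *)
Definition contains_subposet {disp disp' : Order.disp_t}
    (P : finPOrderType disp) (Q : finPOrderType disp') : bool :=
  `[< exists f : Q -> P, {mono f : x y / x <= y} >].

(* S_k has 2k points, so the bound k <= #|P| excludes no copy of S_k in P. *)
Definition se {disp : Order.disp_t} (P : finPOrderType disp) : nat :=
  if contains_subposet P (standard_example 2)
  then \max_(2 <= k < #|P|.+1 | contains_subposet P (standard_example k)) k
  else 1%N.

Definition is_partial_order n (r : {set 'I_n * 'I_n}) : bool :=
  [&& [forall x, (x, x) \in r],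
      [forall x, forall y, ((x, y) \in r) && ((y, x) \in r) ==> (x == y)]
    & [forall x, forall y, forall z,
         ((x, y) \in r) && ((y, z) \in r) ==> ((x, z) \in r)]].

Definition poset (n : nat) := {r : {set 'I_n * 'I_n} | is_partial_order r}.

HB.instance Definition _ n := Finite.on (poset n).

(* Rebinding the carrier keeps this order apart from the usual one on 'I_n. *)
Definition points n (r : poset n) : Type := 'I_n.

Section Points.
Variables (n : nat) (r : poset n).

HB.instance Definition _ := Finite.on (points r).

Definition points_le : rel (points r) := fun x y => (x, y) \in val r.

Lemma points_le_refl : reflexive points_le.
Proof. by move=> x; case/and3P: (valP r) => /forallP/(_ x). Qed.

Lemma points_le_anti : antisymmetric points_le.
Proof.
move=> x y; case/and3P: (valP r) => _ /forallP/(_ x)/forallP/(_ y)/implyP H _.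
by move/H/eqP.
Qed.

Lemma points_le_trans : transitive points_le.
Proof.
move=> y x z; case/and3P: (valP r) => _ _.
move=> /forallP/(_ x)/forallP/(_ y)/forallP/(_ z)/implyP H xy yz.
by apply: H; apply/andP.
Qed.

HB.instance Definition _ := Order.Le_isPOrder.Build (Order.Disp tt tt)
  (points r) points_le_refl points_le_anti points_le_trans.

End Points.

(* Every poset on n points is isomorphic to some [points r]. *)
Definition f (d n : nat) : nat :=
  \max_(r : poset n | (se (points r) < d)%N) dim (points r).

(* Main.v *)
Require Import Defs.
From mathcomp Require Import all_boot all_order all_algebra.
From mathcomp Require Import all_classical all_reals all_analysis.
From mathcomp Require Import zify ring lra.

Import Order.TTheory GRing.Theory Num.Theory.

Set Implicit Arguments.
Unset Strict Implicit.

Local Open Scope ring_scope.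

(** The poset is a random bipartite graph with a few vertices isolated.

    Take a lower side and an upper side of about [n / 2] points each, and put
    [a < b] independently with probability [p], where [p] is slightly more than
    [q = n^(-(2d-1)/(d(d-1)))].  The expected number of copies of [S_d] is at most
    [(n^2/4)^d p^(d(d-1))], which the choice of the exponent makes a small multiple
    of [n].  Isolating one lower vertex of every copy destroys all of them and
    leaves most of the pairs untouched.

    The dimension is bounded below by counting reversed pairs.  Let [k] be about
    [2 log n / p].  With positive probability every [k.+1] lower and [k.+1] upper
    points span a comparability.  Then the pairs [(a, b)] that one linear extension
    reverses form a staircase containing no square of side [k.+1], so there are at
    most [k n] of them ([card_reversed_le]), whereas a realizer has to reverse
    nearly all of the [n^2 / 4] pairs ([card_nonle_le_dim]).  Hence the dimension is
    at least about [n / (4k)], that is [n p / (8 log n)].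

    The probabilistic part is one averaging argument ([exists_poset_dim]): copies
    of [S_d], edges and empty rectangles are weighted by what they cost, and some
    graph costs no more than the average.  As the constant 8 leaves no room in the
    leading term, [p] is taken to be [(1 + 1/(2d)) q]; this gain exceeds the
    fraction [2^-d] of the pairs lost by isolating vertices
    ([deletion_loss_le_gain]). *)

(** * Pairs reversed by a linear extension *)

Lemma exists_inj_ord (T : finType) (C : {set T}) k : (k < #|C|)%N ->
  exists2 c : 'I_k.+1 -> T, injective c & forall i, c i \in C.
Proof.
move=> ltkC; exists (fun i => enum_val (widen_ord ltkC i)) => [i j|i].
  by move/enum_val_inj/(congr1 val) => /= /ord_inj.
exact: enum_valP.
Qed.

Section Reversal.
Local Open Scope nat_scope.
Context {disp : Order.disp_t} (P : finPOrderType disp) (A B : {set P}) (k : nat).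
Hypothesis dense : forall a b : 'I_k.+1 -> P, injective a -> injective b ->
  (forall i, a i \in A) -> (forall i, b i \in B) ->
  exists i j, (a i <= b j)%O.

(** Call [y] in [B] big when more than [k] elements of [A] lie above it in
    [L].  There are at most [k] big elements: the [L]-largest of [k.+1] big ones
    would have [k.+1] elements of [A] above it, hence above all [k.+1] of them,
    and none of the former could be below one of the latter in [P].  A big element
    contributes at most [#|A|] reversed pairs and any other one at most [k]. *)
Lemma card_reversed_le (L : rel P) : linear_extension L ->
  \sum_(y in B) #|[set x in A | ~~ L x y]| <= k * (#|A| + #|B|).
Proof.
move=> [Lr _ Lt Ltot Lext]; pose U y := [set x in A | ~~ L x y].
pose big := [set y in B | k < #|U y|].
have le_big : #|big| <= k.
  rewrite leqNgt; apply/negP => /exists_inj_ord[b b_inj bP].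
  (* [j0] indexes the [L]-largest of the chosen big elements. *)
  have [j0 /(_ _ isT) maxj0] : exists j0, forall j, true -> L (b j) (b j0).
    have [j0 _ h] := @extremumP P 'I_k.+1 (fun x y => L y x) ord0 predT b
      Lr (fun y x z yx zy => Lt _ _ _ zy yx) (fun x y => Ltot y x) isT.
    by exists j0.
  have := bP j0; rewrite inE => /andP[_ /exists_inj_ord[a a_inj aP]].
  have [i||i [j /Lext Lij]] := dense a_inj b_inj.
  - by have := aP i; rewrite inE => /andP[].
  - by move=> i; have := bP i; rewrite inE => /andP[].
  - by have := aP i; rewrite inE (Lt _ _ _ Lij (maxj0 j)) andbF.
rewrite (bigID (mem big)) /= mulnDr leq_add //.
  rewrite (@leq_trans (\sum_(y in big) #|A|)) //; last first.
    by rewrite sum_nat_const leq_mul2r le_big orbT.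
  rewrite [leqRHS](eq_bigl (fun y => (y \in B) && (y \in big))); last first.
    by move=> y; rewrite inE; case: (y \in B).
  apply: leq_sum => y _; apply: subset_leq_card.
  by apply/fintype.subsetP => x; rewrite inE => /andP[].
have -> : k * #|B| = \sum_(y in B) k by rewrite sum_nat_const mulnC.
rewrite [leqRHS](bigID (mem big)) /= (leq_trans _ (leq_addl _ _)) //.
by apply: leq_sum => y /andP[yB]; rewrite inE yB -leqNgt.
Qed.

(** Every incomparability must be witnessed by some member of a realizer, so the
    bound on the pairs reversed by one linear extension bounds [dim P] below. *)
Lemma card_nonle_le_dim :
  \sum_(y in B) #|[set x in A | ~~ (x <= y)%O]| <= Defs.dim P * (k * (#|A| + #|B|)).
Proof.
rewrite /Defs.dim; case: ex_minnP => t /andP[_ /asboolP[L [Llin LP]]] _.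
apply: (@leq_trans (\sum_(j < t) \sum_(y in B) #|[set x in A | ~~ L j x y]|)).
  rewrite exchange_big /=; apply: leq_sum => y _.
  apply: (@leq_trans #|\bigcup_(j < t) [set x in A | ~~ L j x y]|).
    apply/subset_leq_card/fintype.subsetP => x; rewrite inE => /andP[xA nxy].
    have [j Lj] : exists j, ~~ L j x y.
      apply/existsP; rewrite -negb_forall; apply: contra nxy => /forallP h.
      exact/LP.
    by apply/bigcupP; exists j; rewrite // inE xA.
  elim/big_ind2: _ => [|C1 c1 C2 c2 h1 h2|j _]; rewrite ?cards0 //.
  by rewrite (leq_trans (leq_card_setU _ _)) ?leq_add.
apply: (@leq_trans (\sum_(j < t) k * (#|A| + #|B|))).
  by apply: leq_sum => j _; apply: card_reversed_le.
by rewrite sum_nat_const card_ord.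
Qed.
End Reversal.

(** * Random subsets and the patterns they contain *)

Section RandomSubset.
Variables (R : realFieldType) (p : R) (E : finType).
Hypothesis p01 : 0 <= p <= 1.

Definition bern (v : bool) : R := if v then p else 1 - p.

(** Expectation over a random subset of [E], given by its indicator [G], that
    contains each element independently with probability [p]. *)
Definition expect (h : {ffun E -> bool} -> R) : R :=
  \sum_(G : {ffun E -> bool}) (\prod_e bern (G e)) * h G.

Lemma bern_ge0 v : 0 <= bern v.
Proof. by have /andP[? ?] := p01; rewrite /bern; case: v; lra. Qed.

Lemma expectD g h : expect (fun G => g G + h G) = expect g + expect h.
Proof. by rewrite -big_split; apply: eq_bigr => G _; rewrite mulrDr. Qed.

Lemma expectZ c h : expect (fun G => c * h G) = c * expect h.
Proof. by rewrite /expect mulr_sumr; apply: eq_bigr => G _; rewrite mulrCA. Qed.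

Lemma expect_sum (I : finType) (Q : pred I) (h : I -> {ffun E -> bool} -> R) :
  expect (fun G => \sum_(i | Q i) h i G) = \sum_(i | Q i) expect (h i).
Proof.
by rewrite exchange_big; apply: eq_bigr => G _; rewrite mulr_sumr.
Qed.

(** Independence: the weighted sum over all [G] factors over the elements of
    [E], and the factors outside [S] are [p + (1 - p)]. *)
Lemma expect_cylinder (S : {set E}) (v : bool) :
  expect (fun G => [forall e in S, G e == v]%:R) = bern v ^+ #|S|.
Proof.
have sum_bern e : \sum_b bern b * ((e \in S) ==> (b == v))%:R
                = (if e \in S then bern v else 1).
  by rewrite big_bool /bern; case: (e \in S); case: v => /=; ring.
rewrite -prodr_const (big_mkcond (mem S)) /=.
under [RHS]eq_bigr do rewrite -sum_bern.
rewrite bigA_distr_bigA; apply: eq_bigr => G _.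
rewrite big_split; congr (_ * _).
have [/forallP GS|/forallPn[e nGe]] := boolP [forall e in S, G e == v].
  by rewrite big1 // => e _; rewrite GS.
by rewrite (bigD1 e) //= (negbTE nGe) mul0r.
Qed.

Lemma expect_const c : expect (fun=> c) = c.
Proof.
transitivity (c * bern true ^+ #|finset.set0 : {set E}|); last by rewrite cards0 mulr1.
rewrite -expect_cylinder -expectZ; apply: eq_bigr => G _; congr (_ * _).
by rewrite (_ : [forall e in _, _]) ?mulr1 //; apply/forallP => e; rewrite inE.
Qed.

Lemma exists_le_expect h : exists G, h G <= expect h.
Proof.
have [G _ minG] := @Order.TotalTheory.arg_minP _ _ _ [ffun=> false] predT h isT.
exists G; rewrite -[leLHS]expect_const; apply: ler_sum => H _.
by rewrite ler_wpM2l ?minG // prodr_ge0 // => e _; apply: bern_ge0.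
Qed.

End RandomSubset.

Section Patterns.
Variables (T U : finType).
Implicit Type G : {ffun T * U -> bool}.

(** An embedded [s] by [s] array of cells all of whose positions in [Q] have the
    value [v].  Empty rectangles are the case of a full [Q] and [v = false].  With
    [Q] off the diagonal and [v = true] the patterns include all copies of a
    standard example; the cells on the diagonal are left free, so that a single
    power of [p] bounds the expectation. *)
Definition is_pattern G s (Q : {set 'I_s * 'I_s}) (v : bool)
    (ab : {ffun 'I_s -> T} * {ffun 'I_s -> U}) : bool :=
  [&& injectiveb ab.1, injectiveb ab.2
    & [forall e in Q, G (ab.1 e.1, ab.2 e.2) == v]].

Definition patterns G s Q v := [set ab | @is_pattern G s Q v ab].

(** Union bound: by injectivity the cells of [Q] land on distinct edges, so each
    pair of injections succeeds with probability exactly [bern p v ^+ #|Q|]. *)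
Lemma expect_patterns (R : realFieldType) (p : R) s Q v : 0 <= p <= 1 ->
  expect p (fun G => #|@patterns G s Q v|%:R)
    <= (#|T| * #|U|)%:R ^+ s * bern p v ^+ #|Q|.
Proof.
move=> p01.
under [X in expect p X]boolp.eq_fun => G.
  rewrite -sum1_card big_mkcond /= natr_sum; over.
rewrite expect_sum.
apply: (@le_trans _ _ (\sum_(ab : {ffun 'I_s -> T} * {ffun 'I_s -> U}) bern p v ^+ #|Q|)).
  apply: ler_sum => -[a b] _.
  have [/andP[/injectiveP a_inj /injectiveP b_inj]|nab] :=
      boolP (injectiveb a && injectiveb b); last first.
    rewrite (_ : (fun=> _) = fun=> 0) ?expect_const ?exprn_ge0 ?bern_ge0 //.
    by apply/boolp.funext => G; rewrite inE /is_pattern andbA (negbTE nab).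
  pose F (e : 'I_s * 'I_s) := (a e.1, b e.2).
  have F_inj : injective F by move=> [i j] [i' j'] [/a_inj-> /b_inj->].
  rewrite -(card_imset (mem Q) F_inj) -expect_cylinder.
  apply: ler_sum => G _; rewrite ler_wpM2l ?prodr_ge0 // => [e _|].
    exact: bern_ge0.
  rewrite inE /is_pattern; case: ifP => // /and3P[_ _ /forallP GQ].
  rewrite (_ : [forall e in _, _]) //; apply/forall_inP => _ /imsetP[e eQ ->].
  exact: (implyP (GQ e)).
by rewrite sumr_const card_prod !card_ffun card_ord -expnMn -natrX mulr_natl.
Qed.

End Patterns.

(** * Bipartite posets and standard examples *)

Lemma contains_smaller_standard d k : (d <= k)%N ->
  contains_subposet (standard_example k) (standard_example d).
Proof.
move=> le_dk; apply/boolp.asboolP.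
exists (fun x => match x with
  | inl i => inl (widen_ord le_dk i) | inr i => inr (widen_ord le_dk i) end).
by case=> i [] j.
Qed.

(** [se] is a maximum over the sizes of contained standard examples, and a copy
    of [S_k] with [d <= k] would contain a copy of [S_d]. *)
Lemma se_lt (disp : Order.disp_t) (P : finPOrderType disp) d : (1 < d)%N ->
  ~~ contains_subposet P (standard_example d) -> (se P < d)%N.
Proof.
move=> d_gt1 /boolp.asboolPn noSd; rewrite /se; case: ifP => // _.
rewrite -(prednK (ltnW d_gt1)) ltnS; apply/bigmax_leqP_seq.
move=> k _ /boolp.asboolP[g gP].
rewrite -ltnS (prednK (ltnW d_gt1)) ltnNge; apply/negP => le_dk; apply: noSd.
have /boolp.asboolP[h hP] := contains_smaller_standard le_dk.
by exists (g \o h) => x y /=; rewrite gP hP.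
Qed.

Section BipartitePoset.
Variables (m l : nat) (G : 'I_m -> 'I_l -> bool).

(** The points below [m] are the lower side, the others the upper side. *)
Definition bip_le (x y : 'I_(m + l)) : bool :=
  (x == y) || match fintype.split x, fintype.split y with
           | inl a, inr b => G a b
           | _, _ => false end.

Lemma bip_is_partial_order : is_partial_order [set xy | bip_le xy.1 xy.2].
Proof.
apply/and3P; split.
- by apply/forallP => x; rewrite inE /bip_le eqxx.
- apply/forallP => x; apply/forallP => y; rewrite !inE /bip_le /= (eq_sym y).
  by case: eqP => //=; case: (fintype.split x); case: (fintype.split y) => //= ? ?;
    rewrite andbF.
- apply/forallP => x; apply/forallP => y; apply/forallP => z; rewrite !inE /bip_le /=.
  apply/implyP => /andP[/orP[/eqP->//|xy] /orP[/eqP<-|]]; first by rewrite xy orbT.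
  by move: xy; case: (fintype.split x) => //; case: (fintype.split y).
Qed.

Definition bip_poset : poset (m + l) :=
  exist (fun r => is_true (is_partial_order r)) _ bip_is_partial_order.

Lemma bip_poset_leE (a : 'I_m) (b : 'I_l) :
  ((lshift l a : points bip_poset) <= (rshift m b : points bip_poset))%O = G a b.
Proof.
rewrite /Order.le /= /points_le inE /bip_le /= eq_lrshift.
by rewrite (unsplitK (inl a)) (unsplitK (inr b)).
Qed.

Lemma bip_poset_lt (x y : points bip_poset) : (x < y)%O ->
  exists a b, [/\ x = lshift l a, y = rshift m b & G a b].
Proof.
rewrite lt_neqAle => /andP[/negbTE neq].
rewrite /Order.le /= /points_le inE /bip_le /= [_ == _]neq /=.
case: (split_ordP x) => // a xa; case: (split_ordP y) => // b yb Gab.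
by exists a, b.
Qed.

(** For [1 < d] every point of [S_d] is strictly comparable to another, which
    forces the [a_i] to the lower side and the [a'_j] to the upper side. *)
Lemma bip_no_standard d : (1 < d)%N ->
  (forall (a : 'I_d -> 'I_m) (b : 'I_d -> 'I_l), injective a -> injective b ->
     exists i j, i != j /\ ~~ G (a i) (b j)) ->
  ~~ contains_subposet (points bip_poset) (standard_example d).
Proof.
move=> d_gt1 noG; apply/boolp.asboolPn => -[g gP].
have other (i : 'I_d) : exists j, i != j.
  have [->|] := eqVneq i (Ordinal d_gt1); last by exists (Ordinal d_gt1).
  by exists (Ordinal (ltnW d_gt1)).
have g_lt i j : i != j -> (g (inl i) < g (inr j))%O.
  by move=> ij; rewrite lt_leAnge !gP /Order.le /= ij.
have g_inj : injective g := mono_inj le_refl le_anti gP.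
have /boolp.choice[a aP] (i : 'I_d) : exists a, g (inl i) = lshift l a.
  by have [j /g_lt/bip_poset_lt[a [b []]]] := other i; exists a.
have /boolp.choice[b bP] (j : 'I_d) : exists b, g (inr j) = rshift m b.
  have [i] := other j; rewrite eq_sym => /g_lt/bip_poset_lt[a' [b []]].
  by exists b.
have [i j eq_ij|i j eq_ij|i [j [ij]]] := noG a b.
- by have [] : inl i = inl j :> 'I_d + 'I_d by apply: g_inj; rewrite !aP eq_ij.
- by have [] : inr i = inr j :> 'I_d + 'I_d by apply: g_inj; rewrite !bP eq_ij.
- by rewrite -bip_poset_leE -aP -bP ltW ?g_lt.
Qed.

End BipartitePoset.

(** * Isolating a vertex of every standard example *)

Definition offdiag d : {set 'I_d * 'I_d} := [set e | e.1 != e.2].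

Lemma card_offdiag d : #|offdiag d| = (d * d.-1)%N.
Proof.
have -> : offdiag d = ~: [set (i, i) | i : 'I_d].
  apply/setP => -[i j]; rewrite !inE /=; congr (~~ _).
  by apply/eqP/imsetP => [->|[i' _ [-> ->]]]; first exists j.
by rewrite cardsCs finset.setCK card_prod card_imset ?card_ord => [|i j []//]; nia.
Qed.

Section Deletion.
Variables (m l d k : nat) (G : {ffun 'I_m * 'I_l -> bool}) (i0 : 'I_d).
Hypothesis noY : patterns G [set: 'I_k.+1 * 'I_k.+1]%SET false = finset.set0.

Let X := patterns G (offdiag d) true.

(** One lower vertex of each copy of [S_d] in [G], namely the one numbered
    [i0]. *)
Definition hitting_set : {set 'I_m} :=
  [set (ab : {ffun 'I_d -> 'I_m} * {ffun 'I_d -> 'I_l}).1 i0 | ab in X].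

Let D := hitting_set.
Let G' a b := G (a, b) && (a \notin D).

(** Isolating the hitting set instead of removing it keeps the number of points
    equal to [m + l]. *)
Definition deleted_poset := bip_poset G'.

Let r := deleted_poset.

(** A copy of [S_d] in the new poset is one in [G] as well, so its vertex [i0]
    was isolated; but that vertex has an upper neighbour in the copy. *)
Lemma se_deleted : (1 < d)%N -> (se (points r) < d)%N.
Proof.
move=> d_gt1; apply: se_lt => //; apply: bip_no_standard => // a b a_inj b_inj.
pose ab := ([ffun i => a i], [ffun i => b i]).
have [abX|] := boolP (ab \in X).
  have [j ij] : exists j, i0 != j.
    have [->|] := eqVneq i0 (Ordinal d_gt1); last by exists (Ordinal d_gt1).
    by exists (Ordinal (ltnW d_gt1)).
  exists i0, j; split=> //; rewrite /G' negb_and negbK; apply/orP; right.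
  by apply/imsetP; exists ab; rewrite ?ffunE.
rewrite inE /is_pattern (_ : injectiveb ab.1); last first.
  by apply/injectiveP => i j; rewrite !ffunE => /a_inj.
rewrite (_ : injectiveb ab.2); last first.
  by apply/injectiveP => i j; rewrite !ffunE => /b_inj.
move=> /= /forallPn[[i j]]; rewrite inE negb_imply /= !ffunE => /andP[ij nG].
by exists i, j; rewrite /G' negb_and; move: nG; case: (G _).
Qed.

Let A : {set points r} := [set lshift l a | a in ~: D].
Let B : {set points r} := [set rshift m b | b : 'I_l].

(** Count the incomparable pairs whose lower element survives: all [m * l] pairs
    except the edges of [G] and at most [l] pairs for each isolated vertex.
    Around surviving vertices the poset agrees with [G], so it still has no empty
    rectangle. *)
Lemma dim_deleted :
  (m * l <= Defs.dim (points r) * (k * (m + l))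
            + (l * #|X| + \sum_(e : 'I_m * 'I_l) G e))%N.
Proof.
have lsh_inj : injective (@lshift m l : 'I_m -> points r) by apply: lshift_inj.
have rsh_inj : injective (@rshift m l : 'I_l -> points r) by apply: rshift_inj.
have leD : (#|D| <= #|X|)%N by apply: leq_imset_card.
have leA : (#|A| <= m)%N.
  by rewrite (leq_trans (leq_imset_card _ _)) // -[leqRHS]card_ord max_card.
have leB : (#|B| <= l)%N.
  by rewrite (leq_trans (leq_imset_card _ _)) // -[leqRHS]card_ord max_card.
have dense : forall a b : 'I_k.+1 -> points r, injective a -> injective b ->
    (forall i, a i \in A) -> (forall i, b i \in B) ->
    exists i j, (a i <= b j)%O.
  move=> a b a_inj b_inj aA bB.
  have /boolp.choice[a' aP] i : exists a', a i = lshift l a' /\ a' \notin D.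
    by have /imsetP[a' + ->] := aA i; rewrite inE; exists a'.
  have /boolp.choice[b' bP] i : exists b', b i = rshift m b'.
    by have /imsetP[b' _ ->] := bB i; exists b'.
  have : ([ffun i => a' i], [ffun i => b' i]) \notin
      patterns G [set: 'I_k.+1 * 'I_k.+1]%SET false by rewrite noY inE.
  rewrite inE /is_pattern /=; case/nandP.
    case/negP; apply/injectiveP => i j; rewrite !ffunE => eq_a.
    by apply: a_inj; rewrite (aP i).1 (aP j).1 eq_a.
  case/nandP.
    case/negP; apply/injectiveP => i j; rewrite !ffunE => eq_b.
    by apply: b_inj; rewrite !bP eq_b.
  move/forallPn => [[i j]]; rewrite inE !ffunE /= eqbF_neg negbK => Gij.
  by exists i, j; rewrite (aP i).1 bP bip_poset_leE /G' Gij (aP i).2.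
have nonedges (b : 'I_l) : (m <= #|[set x in A | ~~ (x <= (rshift m b : points r))%O]|
    + (#|X| + \sum_(a < m) G (a, b)))%N.
  have -> : (\sum_(a < m) G (a, b))%N = #|[set a | G (a, b)]|.
    by rewrite -sum1_card [RHS]big_mkcond; apply: eq_bigr => a _; rewrite inE; case: (G _).
  apply: (@leq_trans (#|~: D :\: [set a | G (a, b)]| + (#|D| + #|[set a | G (a, b)]|))%N);
    last first.
    rewrite leq_add ?leq_add // -(card_imset _ lsh_inj).
    apply/subset_leq_card/fintype.subsetP => _ /imsetP[a + ->].
    rewrite !inE => /andP[nG aD]; rewrite bip_poset_leE /G' (negbTE nG) andbT.
    by apply/imsetP; exists a; rewrite ?inE.
  rewrite -[leqLHS]card_ord -[leqLHS]cardsT.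
  apply: (@leq_trans #|(~: D :\: [set a | G (a, b)]) :|: (D :|: [set a | G (a, b)])|).
    apply/subset_leq_card/fintype.subsetP => a _; rewrite !inE.
    by case: (a \in D) (G _) => [] [].
  by rewrite (leq_trans (leq_card_setU _ _)) // leq_add2l leq_card_setU.
apply: (@leq_trans (\sum_(y in B) #|[set x in A | ~~ (x <= y)%O]|
                    + (l * #|X| + \sum_(e : 'I_m * 'I_l) G e))%N); last first.
  rewrite leq_add2r (leq_trans (card_nonle_le_dim dense)) //.
  by rewrite !leq_mul // leq_add.
rewrite big_imset /=; last by move=> ? ? _ _; apply: rsh_inj.
have -> : (\sum_(e : 'I_m * 'I_l) G e = \sum_(b < l) \sum_(a < m) G (a, b))%N.
  by rewrite exchange_big pair_big /=; apply: eq_bigr => -[].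
have -> : (l * #|X| = \sum_(b < l) #|X|)%N by rewrite sum_nat_const card_ord.
rewrite -!big_split /= -[leqLHS]mulnC -{1}(card_ord l) -sum_nat_const.
by apply: leq_sum => b _; apply: nonedges.
Qed.

End Deletion.

(** First moment method applied to a single functional, in which the empty
    rectangles carry the weight [m * l].  Some graph has a value no larger than
    the mean, hence at most [eps * (m * l) < m * l]; such a graph has no empty
    rectangle at all, and its value bounds the loss in [dim_deleted]. *)
Lemma exists_poset_dim (R : realFieldType) (p eps : R) (m l d k : nat) :
  (1 < d)%N -> (0 < m * l)%N -> 0 <= p <= 1 -> eps < 1 ->
  l%:R * ((m * l)%:R ^+ d * p ^+ (d * d.-1))
    + ((m * l)%:R * p
       + (m * l)%:R * ((m * l)%:R ^+ k.+1 * (1 - p) ^+ (k.+1 * k.+1)))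
    <= eps * (m * l)%:R ->
  exists r : poset (m + l), (se (points r) < d)%N /\
    (1 - eps) * (m * l)%:R <= (Defs.dim (points r))%:R * (k%:R * (m + l)%:R).
Proof.
move=> d_gt1 ml_gt0 p01 eps_lt1 bound.
pose X (G : {ffun 'I_m * 'I_l -> bool}) := patterns G (offdiag d) true.
pose Y (G : {ffun 'I_m * 'I_l -> bool}) :=
  patterns G [set: 'I_k.+1 * 'I_k.+1]%SET false.
pose h (G : {ffun 'I_m * 'I_l -> bool}) : R := l%:R * #|X G|%:R
  + (\sum_e (G e)%:R + (m * l)%:R * #|Y G|%:R).
have [G hG] := exists_le_expect p01 h.
have {bound}hG : h G <= eps * (m * l)%:R.
  apply: le_trans hG _; apply: le_trans bound.
  rewrite !expectD !expectZ lerD ?lerD //.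
  - apply: ler_wpM2l => //; apply: le_trans (@expect_patterns _ _ _ _ _ _ _ p01) _.
    by rewrite card_offdiag !card_ord.
  - rewrite expect_sum (eq_bigr (fun=> p)) => [|e _].
      by rewrite sumr_const card_prod !card_ord mulr_natl.
    transitivity (bern p true ^+ #|[set e]|); last by rewrite cards1.
    rewrite -expect_cylinder; congr expect; apply/boolp.funext => G'.
    congr (_%:R); congr nat_of_bool; apply/idP/forall_inP => [Ge e'|].
      by rewrite inE => /eqP->; rewrite Ge.
    by move/(_ e); rewrite inE eqxx => /(_ isT)/eqP.
  - apply: ler_wpM2l => //; apply: le_trans (@expect_patterns _ _ _ _ _ _ _ p01) _.
    by rewrite cardsT card_prod !card_ord.
have ml_gt0R : 0 < (m * l)%:R :> R by rewrite ltr0n.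
have noY : Y G = finset.set0.
  apply/eqP; rewrite -cards_eq0 -leqn0 leqNgt; apply/negP => Y_ge1.
  have : h G < (m * l)%:R * 1 by rewrite (le_lt_trans hG) // mulrC ltr_pM2l.
  apply/negP; rewrite -leNgt; apply: (@le_trans _ _ ((m * l)%:R * #|Y G|%:R)).
    by rewrite ler_pM2l // ler1n.
  by rewrite /h addrA lerDr addr_ge0 ?mulr_ge0 ?sumr_ge0.
pose i0 := Ordinal (ltnW d_gt1).
have := dim_deleted i0 noY; rewrite -(ler_nat R) => dimr.
exists (deleted_poset G i0).
split; first exact: se_deleted.
rewrite mulrBl mul1r lerBlDr; apply: le_trans dimr _.
rewrite natrD !natrM -(natrM _ m l) lerD2l; apply: le_trans hG.
by rewrite /h noY cards0 mulr0 addr0 natrD natrM natr_sum.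
Qed.

(** * Estimates *)

Section Estimates.
Variable R : realType.
Implicit Types x p q mu : R.

Lemma expR_half_le2 : expR (2^-1 : R) <= 2.
Proof.
have := expR_ge1Dx (- 2^-1 : R); rewrite expRN => h.
rewrite -(invrK (expR _)) -[leRHS]invrK lef_pV2 ?posrE ?invr_gt0 ?expR_gt0 //.
by apply: le_trans h; lra.
Qed.

(** [(1 + 1/(2d))^d] stays below [exp(1/2)]. *)
Lemma pow_1Dhalf_le2 d : (1 + (2 * d%:R)^-1 : R) ^+ d <= 2.
Proof.
have [->|d_gt0] := posnP d; first by rewrite expr0; lra.
apply: le_trans expR_half_le2.
rewrite (_ : 2^-1 = d%:R * (2 * d%:R)^-1); last first.
  by field; rewrite pnatr_eq0 -lt0n.
rewrite expRM_natl lerXn2r ?nnegrE ?expR_ge1Dx ?expR_ge0 //.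
Qed.

Lemma half_le_ln x : 4 <= x -> 2^-1 <= ln x.
Proof.
move=> x_ge4; rewrite -[leLHS]expRK ler_ln ?posrE ?expR_gt0 //; last by lra.
by apply: le_trans expR_half_le2 _; lra.
Qed.

(** For [K > 2 log x / p] we have [(1 - p)^K <= exp(- p K) <= x^-2], so that the
    left-hand side is at most [(x^2/4 * x^-2)^K = 4^-K <= 1/K <= p]. *)
Lemma empty_rectangle_term x p mu K : 4 <= x -> 0 < p <= 1 ->
  0 <= mu <= x ^+ 2 / 4 -> 2 * ln x / p < K%:R ->
  mu ^+ K * (1 - p) ^+ (K * K) <= p.
Proof.
move=> x_ge4 /andP[p_gt0 p_le1] /andP[mu_ge0 mu_le] K_gt.
have x_gt0 : 0 < x by lra.
have lnx := half_le_ln x_ge4.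
have pK : 2 * ln x < p * K%:R by rewrite [ltRHS]mulrC -ltr_pdivrMr.
have q_le : (1 - p) ^+ K <= (x ^+ 2)^-1.
  apply: (@le_trans _ _ (expR (- p) ^+ K)).
    by rewrite lerXn2r ?nnegrE ?expR_ge0 ?expR_ge1Dx //; lra.
  rewrite -expRM_natl mulrN expRN lef_pV2 ?posrE ?expR_gt0 ?exprn_gt0 //.
  rewrite -[X in X ^+ 2](lnK x_gt0) -expRM_natl ler_expR; lra.
rewrite exprM -exprMn.
apply: (@le_trans _ _ (4^-1 ^+ K)).
  rewrite lerXn2r ?nnegrE ?mulr_ge0 ?exprn_ge0 ?invr_ge0 //; first lra.
  apply: (@le_trans _ _ (x ^+ 2 / 4 * (x ^+ 2)^-1)).
    by rewrite ler_pM // exprn_ge0 //; lra.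
  by rewrite mulrAC divff ?mul1r // expf_neq0 // gt_eqF.
have K_gt0 : 0 < K%:R :> R by rewrite -(pmulr_rgt0 _ p_gt0); lra.
rewrite exprVn; apply: (@le_trans _ _ K%:R^-1).
  by rewrite lef_pV2 ?posrE ?exprn_gt0 // -natrX ler_nat ltnW // ltn_expl.
by rewrite -[leLHS]mul1r ler_pdivrMr //; lra.
Qed.

(** The exponent of [q] is chosen so that [q^(d(d-1))] cancels [x^(2d-1)].  What
    remains are the constants: halving both sides of the graph wins
    [2^-(2d-1)], of which the factor [1 + 1/(2d)] gives back at most
    [2^(d-1)]. *)
Lemma standard_example_term x q mu l d : (0 < d)%N -> 0 < x -> 0 <= q ->
  q ^+ (d * d.-1) * x ^+ (2 * d).-1 = 1 ->
  0 <= mu <= x ^+ 2 / 4 -> 0 <= l <= x / 2 ->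
  l * (mu ^+ d * ((1 + (2 * d%:R)^-1) * q) ^+ (d * d.-1)) <= 2^-1 ^+ d * mu.
Proof.
case: d => // e _ x_gt0 q_ge0 qx /andP[mu_ge0 mu_le] /andP[l_ge0 l_le].
set c := 1 + _; have c_ge0 : 0 <= c by rewrite addr_ge0 // invr_ge0 mulr_ge0.
rewrite -pred_Sn in qx *.
rewrite (exprS mu) (_ : l * _ = mu * (l * mu ^+ e * (c * q) ^+ (e.+1 * e))); last by ring.
rewrite mulrC ler_wpM2r //.
have le1 : l * mu ^+ e <= x ^+ (2 * e.+1).-1 / (2 * 4 ^+ e).
  apply: (@le_trans _ _ (x / 2 * (x ^+ 2 / 4) ^+ e)).
    by rewrite ler_pM ?exprn_ge0 // lerXn2r ?nnegrE //; lra.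
  rewrite expr_div_n -exprM (_ : (2 * e.+1).-1 = (2 * e).+1)%N; last by lia.
  by rewrite exprS invfM; lra.
have le2 : c ^+ (e.+1 * e) <= 2 ^+ e.
  by rewrite exprM lerXn2r ?nnegrE ?exprn_ge0 ?pow_1Dhalf_le2.
rewrite exprMn.
apply: (@le_trans _ _ (x ^+ (2 * e.+1).-1 / (2 * 4 ^+ e) * (2 ^+ e * q ^+ (e.+1 * e)))).
  by rewrite ler_pM ?mulr_ge0 ?exprn_ge0 // ler_wpM2r ?exprn_ge0.
rewrite (_ : _ * _ = q ^+ (e.+1 * e) * x ^+ (2 * e.+1).-1 * (2 ^+ e / (2 * 4 ^+ e)));
  last by ring.
rewrite qx mul1r (_ : 4 = 2 * 2 :> R); last by ring.
rewrite exprMn exprVn exprS le_eqVlt; apply/orP; left; apply/eqP.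
by field; rewrite expf_neq0.
Qed.

(** With edge probability [q] itself, the constant 8 would allow no loss of pairs.
    Raising the edge probability by the factor [1 + 1/(2d)] outweighs the
    lost fraction [2^-d <= 1/(2d+2)] as soon as [q] is small, because
    [(1 - 1/(2d+2) - 1/((2d+1)(2d+2))) * (1 + 1/(2d)) = 1]. *)
Lemma deletion_loss_le_gain d p q : (3 <= d)%N -> 0 <= q ->
  q * (4 * ((2 * d%:R + 1) * (2 * d%:R + 2))) <= 1 ->
  p = (1 + (2 * d%:R)^-1) * q ->
  1 <= (1 - 2^-1 ^+ d - 3 * p) * (1 + (2 * d%:R)^-1).
Proof.
move=> d_ge3 q_ge0 q_small ->.
have D3 : 3 <= d%:R :> R by rewrite (ler_nat _ 3).
have pow : (2^-1 : R) ^+ d <= (2 * d%:R + 2)^-1.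
  have pos : 0 < 2 * d%:R + 2 :> R by lra.
  rewrite exprVn lef_pV2 ?posrE ?exprn_gt0 //.
  rewrite -natrX -natrM -natrD ler_nat.
  by elim: (d) d_ge3 => // -[|[|[|e]]] // IH _; have := IH isT; rewrite (expnS 2 _.+3); lia.
have inv : (2 * d%:R)^-1 <= 6^-1 :> R by rewrite lef_pV2 ?posrE; lra.
have q4 : 4 * q <= ((2 * d%:R + 1) * (2 * d%:R + 2))^-1.
  by rewrite -[leRHS]mul1r ler_pdivlMr; nra.
apply: (@le_trans _ _ ((1 - (2 * d%:R + 2)^-1 - ((2 * d%:R + 1) * (2 * d%:R + 2))^-1)
    * (1 + (2 * d%:R)^-1))).
  by rewrite le_eqVlt; apply/orP; left; apply/eqP; field; rewrite !gt_eqF //; lra.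
rewrite ler_wpM2r ?addr_ge0 ?invr_ge0 ?mulr_ge0 //.
by nra.
Qed.

End Estimates.

(** * The lower bound *)

Lemma dim_le_f d n (r : poset n) :
  (se (points r) < d)%N -> (Defs.dim (points r) <= f d n)%N.
Proof.
rewrite /f => se_r.
exact: (@leq_bigmax_cond _ (fun r : poset n => se (points r) < d)%N
          (fun r : poset n => Defs.dim (points r)) r se_r).
Qed.

Lemma half_product_bounds n (l := n./2) (m := (n - n./2)%N) : (1 < n)%N ->
  [/\ n = (m + l)%N, (0 < m * l)%N, (l * 2 <= n)%N, (4 * (m * l) <= n * n)%N
    & (n * n <= 4 * (m * l) + 1)%N].
Proof.
have := odd_double_half n; rewrite {}/m {}/l; move: (n./2) (odd n) => l b.
rewrite -muln2 => <-; have -> : (b + l * 2 - l = b + l)%N by lia.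
by case: b; split; nia.
Qed.

Theorem theorem6p2 (R : realType) (d : nat) (hd : (3 <= d)%N) :
  exists N : nat, forall n : nat, (N <= n)%N ->
    n%:R `^ (1 - (2 * d%:R - 1) / (d%:R * (d%:R - 1))) / (8 * ln n%:R)
      <= (f d n)%:R :> R.
Proof.
(* [n] is large enough once [n^(1/d) >= C]: the exponent of [q] below is at
   most [-1/d], so this gives [q <= 1/C]. *)
pose C := (4 * ((2 * d + 1) * (2 * d + 2)))%N.
exists (C ^ d)%N => n le_n.
have C_gt0 : (0 < C)%N by rewrite /C; lia.
have n_ge4 : (4 <= n)%N.
  rewrite (leq_trans _ le_n) // (leq_trans _ (leq_pexp2l C_gt0 (ltnW (ltnW hd)))) //.
  by rewrite /C; nia.
have d_gt0 : (0 < d)%N := ltnW (ltnW hd).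
have n_gt0 : (0 < n)%N by lia.
set theta := (2 * d%:R - 1) / _; set x : R := n%:R; set D : R := d%:R in theta *.
have D3 : 3 <= D by rewrite /D (ler_nat _ 3).
have x4 : 4 <= x by rewrite /x (ler_nat _ 4).
have x_gt0 : 0 < x by lra.
have x_ge0 := ltW x_gt0.
have D_ge0 : 0 <= D by lra.
have x_neq0 : x != 0 by rewrite gt_eqF.
pose q := x `^ (- theta).
have q_gt0 : 0 < q by apply: powR_gt0.
have DD_gt0 : 0 < D * (D - 1) by nra.
have q_pow : q ^+ (d * d.-1) * x ^+ (2 * d).-1 = 1.
  rewrite -!powR_mulrn ?powR_ge0 ?ltW // -powRrM -powRD ?x_neq0 ?implybT //.
  rewrite (_ : _ + _ = 0) ?powRr0 // -!subn1 natrM !natrB ?natrM ?muln_gt0 /theta -/D;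
    try lia.
  by field; rewrite !gt_eqF //; lra.
have xq : x `^ (1 - theta) = x * q.
  by rewrite powRD ?x_neq0 ?implybT // powRr1 // ltW.
have xq_ge1 : 1 <= x * q.
  rewrite -xq -[leLHS](powRr0 x) ler_powR //; first lra.
  by rewrite subr_ge0 ler_pdivrMr // mul1r; nra.
have q_small : q * (4 * ((2 * D + 1) * (2 * D + 2))) <= 1.
  rewrite (_ : 4 * _ = C%:R); last by rewrite /C !(natrM, natrD).
  have q_le : q <= (x `^ D^-1)^-1.
    rewrite -powRN ler_powR //; first lra.
    rewrite lerN2 ler_pdivlMr // mulrA mulVf ?mul1r; last by rewrite gt_eqF; lra.
    lra.
  rewrite -ler_pdivlMr ?ltr0n ?mul1r //.
  apply: le_trans q_le _; rewrite lef_pV2 ?posrE ?powR_gt0 ?ltr0n //.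
  have <- : (C%:R ^+ d : R) `^ D^-1 = C%:R.
    by rewrite -powR_mulrn // -powRrM mulfV ?powRr1 //; rewrite gt_eqF; lra.
  apply: ge0_ler_powR; rewrite ?nnegrE ?invr_ge0 ?exprn_ge0 //.
  by rewrite -natrX ler_nat.
(* The factor [1 + 1/(2d)] pays for the pairs lost to edges and isolated
   vertices. *)
pose p := (1 + (2 * D)^-1) * q.
have /andP[D_inv_gt0 D_inv_le] : 0 < (2 * D)^-1 <= 6^-1.
  by rewrite invr_gt0 lef_pV2 ?posrE; lra.
have qp : q <= p by rewrite /p; nra.
have p_small : 3 * p <= 1.
  have W_ge1 : 1 <= (2 * D + 1) * (2 * D + 2) by nra.
  have q4 : q * 4 <= 1 by apply: le_trans q_small; rewrite ler_wpM2l ?ltW //; lra.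
  have : (2 * D)^-1 * q <= 6^-1 * q by rewrite ler_wpM2r // ltW.
  by rewrite /p; lra.
have p_gt0 : 0 < p by lra.
have := deletion_loss_le_gain hd (ltW q_gt0) q_small erefl; rewrite -/D -/p => slack_p.
have lnx := half_le_ln x4.
(* Empty rectangles are excluded from side [k.+1] on, while [k] enters the
   dimension bound; rounding down serves both. *)
pose k := Num.truncn (2 * ln x / p).
have /andP[k_le k_gt] : k%:R <= 2 * ln x / p < k.+1%:R.
  by apply: truncn_itv; rewrite divr_ge0 //; lra.
(* The smaller half is the upper side: the loss per isolated lower vertex is
   [l], which [standard_example_term] needs to be at most [n / 2]. *)
pose l := n./2; pose m := (n - n./2)%N.
have [eq_n ml_gt0 l_le mu_le mu_ge] := half_product_bounds (ltnW (ltnW n_ge4)).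
rewrite -/l -/m in eq_n ml_gt0 l_le mu_le mu_ge.
pose mu : R := (m * l)%:R.
have mu_leR : mu <= x ^+ 2 / 4.
  by rewrite ler_pdivlMr // /x -natrX -natrM ler_nat -mulnn mulnC.
have mu_geR : x ^+ 2 - 1 <= 4 * mu.
  by rewrite lerBlDr /x /mu -natrX -natrM natr1 ler_nat -mulnn -addn1.
have mu_gt0 : 0 < mu by rewrite ltr0n.
have l_leR : 0 <= (l%:R : R) <= x / 2.
  by rewrite ler0n ler_pdivlMr // /x -natrM ler_nat.
have mu_itv : 0 <= mu <= x ^+ 2 / 4 by rewrite ltW.
(* [2^-d] accounts for the copies of [S_d], one [p] for the edges and one [p]
   for the empty rectangles. *)
pose eps := 2^-1 ^+ d + 2 * p.
have eps_lt1 : eps < 1.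
  rewrite /eps; nra.
have p01 : 0 <= p <= 1 by apply/andP; split; lra.
have [|r [se_r dim_r]] :=
    @exists_poset_dim R p eps m l d k (ltnW hd) ml_gt0 p01 eps_lt1.
  rewrite -/mu /eps mulrDl lerD //.
    exact: standard_example_term d_gt0 x_gt0 (ltW q_gt0) q_pow mu_itv l_leR.
  rewrite (_ : 2 * p * mu = mu * p + mu * p); last by ring.
  rewrite lerD2l ler_pM2l //.
  by apply: (@empty_rectangle_term _ x) => //; apply/andP; split; lra.
rewrite -eq_n -/x -/mu in r se_r dim_r *.
apply: (@le_trans _ _ (Defs.dim (points r))%:R); last by rewrite ler_nat dim_le_f.
set t : R := (Defs.dim (points r))%:R in dim_r *.
have t_ge0 : 0 <= t by rewrite ler0n.
have kp : k%:R * p <= 2 * ln x by rewrite -ler_pdivlMr.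
have eps_ge0 : 0 <= eps by rewrite addr_ge0 ?exprn_ge0 ?invr_ge0 //; lra.
have xp_ge1 : 1 <= x ^+ 2 * p.
  by rewrite expr2 -mulrA; apply: mulr_ege1; [lra|rewrite (le_trans xq_ge1) // ler_wpM2l].
rewrite xq ler_pdivrMr; last by lra.
rewrite -(ler_pM2l x_gt0) mulrA -expr2.
apply: (@le_trans _ _ (4 * ((1 - eps) * mu * p))); last first.
  apply: (@le_trans _ _ (4 * (t * (k%:R * x) * p))).
    by rewrite ler_pM2l // ler_pM2r.
  rewrite (_ : 4 * _ = 4 * t * x * (k%:R * p)); last by ring.
  rewrite (_ : x * _ = 4 * t * x * (2 * ln x)); last by ring.
  by rewrite ler_wpM2l // !mulr_ge0.
apply: (@le_trans _ _ (x ^+ 2 * ((1 - eps) * (1 - p)) * p)); last first.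
  rewrite (_ : 4 * _ = 4 * mu * ((1 - eps) * p)); last by ring.
  rewrite (_ : _ * p = (x ^+ 2 - x ^+ 2 * p) * ((1 - eps) * p)); last by ring.
  by rewrite ler_wpM2r ?mulr_ge0 ?subr_ge0 ?(ltW eps_lt1) ?(ltW p_gt0) //; lra.
rewrite -mulrA ler_pM2l ?exprn_gt0 //.
apply: (@le_trans _ _ ((1 - 2^-1 ^+ d - 3 * p) * p)).
  rewrite {2}/p mulrA -[leLHS]mul1r ler_wpM2r //; exact: ltW.
rewrite ler_pM2r //.
have -> : (1 - eps) * (1 - p) = (1 - 2^-1 ^+ d - 3 * p) + eps * p.
  by rewrite /eps; move: (2^-1 ^+ d) (p) => u v; ring.
by rewrite lerDl mulr_ge0 // ltW.
Qed.
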